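(* Let $0\le a<b$, $0\le c<d$, $\Delta=[a,b]\times[c,d]$, and let $f:\Delta\to\mathbb{R}$ be a partial differentiable mapping on $\Delta$ with $\frac{\partial^2 f}{\partial t\partial\lambda}\in L(\Delta)$. Let $q>1$, let $p$ satisfy $p^{-1}+q^{-1}=1$, let $s\in(0,1]$ be fixed, put $D:=\left|\frac{\partial^2 f}{\partial t\partial\lambda}\right|$, and suppose that $D^q$ is $s$-convex in the second sense on the co-ordinates on $\Delta$. Then for $x\in[a,b]$ and $y\in[c,d]$, $$\left|\frac{1}{(b-a)(d-c)}\left[A-(x-a)\int_c^d f(a,v)\,dv-(b-x)\int_c^d f(b,v)\,dv-(d-y)\int_a^b f(u,d)\,du-(y-c)\int_a^b f(u,c)\,du+\int_a^b\int_c^d f(u,v)\,du\,dv\right]\right|$$ $$\le\frac{1}{(p+1)^{2/p}}\frac{1}{(s+1)^{2/q}}\Bigg\{\frac{(x-a)^2(y-c)^2}{(b-a)(d-c)}\left(D(x,y)^q+D(x,c)^q+D(a,y)^q+D(a,c)^q\right)^{1/q}$$ $$+\frac{(x-a)^2(d-y)^2}{(b-a)(d-c)}\left(D(x,y)^q+D(x,d)^q+D(a,y)^q+D(a,d)^q\right)^{1/q}$$ $$+\frac{(b-x)^2(y-c)^2}{(b-a)(d-c)}\left(D(x,y)^q+D(x,c)^q+D(b,y)^q+D(b,c)^q\right)^{1/q}$$ $$+\frac{(b-x)^2(d-y)^2}{(b-a)(d-c)}\left(D(x,y)^q+D(x,d)^q+D(b,y)^q+D(b,d)^q\right)^{1/q}\Bigg\},$$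 where $$A=\frac{(x-a)(y-c)f(a,c)+(x-a)(d-y)f(a,d)}{(b-a)(d-c)}+\frac{(b-x)(y-c)f(b,c)+(b-x)(d-y)f(b,d)}{(b-a)(d-c)}.$$
   Context: $\frac{\partial^2 f}{\partial t\partial\lambda}(u,v)$ denotes the mixed second partial derivative of $f$ with respect to its first and second variables, evaluated at $(u,v)$; $L(\Delta)$ is the space of integrable functions on $\Delta$. In the double integral $u$ ranges over $[a,b]$ and $v$ over $[c,d]$. For $s\in(0,1]$, a function $g:[\alpha,\beta]\to\mathbb{R}$ with $[\alpha,\beta]\subset[0,\infty)$ is $s$-convex in the second sense if $g(\mu u+(1-\mu)v)\le\mu^s g(u)+(1-\mu)^s g(v)$ for all $u,v\in[\alpha,\beta]$, $\mu\in[0,1]$. A function $g:\Delta=[a,b]\times[c,d]\to\mathbb{R}$ with $\Delta\subset[0,\infty)^2$ is $s$-convex in the second sense on the co-ordinates on $\Delta$ if the partial mappings $u\mapsto g(u,y)$ on $[a,b]$ and $v\mapsto g(x,v)$ on $[c,d]$ are $s$-convex in the second sense for all $y\in[c,d]$ and $x\in[a,b]$.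
   Formalization: A is taken without its denominators (b-a)(d-c): as printed the inequality fails for f=1, where D=0 and the right side is 0 but the left side is |1-(b-a)(d-c)|/((b-a)(d-c)), nonzero unless (b-a)(d-c)=1. *)

(* Defs.v *)
From HB Require Import structures.
From mathcomp Require Import all_boot all_order all_algebra.
From mathcomp Require Import all_classical all_reals all_analysis.
Set Implicit Arguments.
Unset Strict Implicit.
Unset Printing Implicit Defensive.
Import Order.TTheory GRing.Theory Num.Theory.
Import numFieldNormedType.Exports.
Local Open Scope classical_set_scope.
Local Open Scope ring_scope.

(* A function on a set I is represented by a total function R -> R.  The
   derivative relative to I only looks at values on I, so it is one-sided at the
   endpoints of an interval ([derivable] and [f^`()] are two-sided and would
   depend on values outside I). *)
Definition derivable_on (R : realType) (I : set R) (g : R -> R) (x : R) : Prop :=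
  cvg ((g u - g x) / (u - x) @[u --> within I x^']).

Definition derive_on (R : realType) (I : set R) (g : R -> R) (x : R) : R :=
  lim ((g u - g x) / (u - x) @[u --> within I x^']).

Section partial.
Variables (R : realType) (a b c d : R).
Implicit Type f : R -> R -> R.

Definition rectangle : set (R * R) := `[a, b] `*` `[c, d].

Definition partial1 f (u v : R) : R := derive_on `[a, b] (f ^~ v) u.

Definition partial2 f (u v : R) : R := derive_on `[c, d] (f u) v.

Definition partially_differentiable f : Prop :=
  forall u v, rectangle (u, v) ->
    derivable_on `[a, b] (f ^~ v) u /\ derivable_on `[c, d] (f u) v.

(* d^2 f / (dt dlambda) = d/dt (df/dlambda): first differentiate in the second
   variable, then in the first. *)
Definition mixed_partial f : R -> R -> R := partial1 (partial2 f).

Definition has_mixed_partial f : Prop :=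
  forall u v, rectangle (u, v) -> derivable_on `[a, b] (partial2 f ^~ v) u.

Definition integrable_on_rectangle (g : R -> R -> R) : Prop :=
  (@lebesgue_measure R \x @lebesgue_measure R)%E.-integrable rectangle
    (fun z => (g z.1 z.2)%:E).

End partial.

Definition s_convex2 (R : realType) (s : R) (I : set R) (g : R -> R) : Prop :=
  forall u v mu : R, I u -> I v -> 0 <= mu <= 1 ->
    g (mu * u + (1 - mu) * v) <= mu `^ s * g u + (1 - mu) `^ s * g v.

Definition coord_s_convex2 (R : realType) (s a b c d : R) (g : R -> R -> R) : Prop :=
  (forall y, `[c, d]%classic y -> s_convex2 s `[a, b] (g ^~ y)) /\
  (forall x, `[a, b]%classic x -> s_convex2 s `[c, d] (g x)).

(* No factor 1 / ((b - a) (d - c)) here: the quantity below is what two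
   integrations by parts of (u - x) (v - y) d^2 f / (dt dlambda) produce before
   the whole combination is divided by (b - a) (d - c). *)
Definition corner_term (R : realType) (a b c d x y : R) (f : R -> R -> R) : R :=
  (x - a) * (y - c) * f a c + (x - a) * (d - y) * f a d
  + ((b - x) * (y - c) * f b c + (b - x) * (d - y) * f b d).

(* Main.v *)
Require Import Defs.
From HB Require Import structures.
From mathcomp Require Import all_boot all_order all_algebra.
From mathcomp Require Import all_classical all_reals all_analysis.
From mathcomp Require Import measurable_realfun ring lra.
Set Implicit Arguments.
Unset Strict Implicit.
Unset Printing Implicit Defensive.

Import Order.TTheory GRing.Theory Num.Theory.
Import numFieldNormedType.Exports.
Local Open Scope classical_set_scope.
Local Open Scope ring_scope.

(** The line through [x] and the line through [y] cut the rectangle into four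
quadrants, each with one corner [(e, e')] of the rectangle and the apex
[(x, y)].  Let [T] be the integral over such a quadrant of the increment
[f u v - f e v - f u e' + f e e'].  Expanding these increments shows that the
quantity to be bounded is the sum of the four [T]
([quadrant_decomposition]); this takes only additivity of the integral and one
exchange of the order of integration, for the continuous function [f].

For one quadrant, let [w] be the mixed derivative and let [t] and [la] be the
fractions [(x - u) / (x - e)] and [(y - v) / (y - e')], which are 0 at the apex
and 1 at the corner.  Formally [T] is the integral of [(x - u) (y - v) w u v],
hence [|T|] is at most (area)^2 times the mean of [t la |w|].  By Hoelder this
mean is at most the product of the L^p norm of [t la], which is
[(p + 1)^(- 2 / p)], and the L^q norm of [w].  Convexity in each variable bounds
[|w|^q] by a combination of its four values at the vertices of the quadrant with
weights such as [t^s la^s], [t^s (1 - la)^s], each of mean [1 / (s + 1)^2].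
This gives the factor [(s + 1)^(- 2 / q)] and the sum of four values in the
statement.

The mixed derivative is merely defined everywhere, so this is not proved by
integrating [w].  Hoelder is replaced by the pointwise Young inequality with a
parameter [tau]:
[t la |w| <= tau^p (t la)^p / p + tau^(- q) |w|^q / q].
After the convexity bound the right-hand side is an explicit sum of products of
powers.  The mean value inequality turns such a pointwise bound on a derivative
into a bound on the integral of the increments ([Rintegral_base_bound]).  It
is applied in [u] to the partial derivative of [f] in [v], and then in [v] to the
integral over [u] of [f u v - f e v], which is differentiated under the integral
sign ([quadrant_powR_bound]).  The best [tau] restores the Hoelder bound
([young_optimum], [quadrant_bound]).

Convexity also makes [w] bounded, by its values at the four vertices
([coord_s_convex2_bounded]).  This boundedness is what makes the mixed
increments Lipschitz, [f] continuous, and differentiation under the integral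
sign legitimate. *)

(** * Relative derivatives and functions differentiable inside an interval *)

Section relative_derivative.
Variables (R : realType) (a b : R) (g : R -> R) (x : R).
Hypothesis dg : derivable_on `[a, b] g x.

Lemma derivable_on_continuous : g u @[u --> within `[a, b] (nbhs x)] --> g x.
Proof.
apply/cvgrPdist_lt => e e0.
have Q : (g x + (g u - g x) / (u - x) * (u - x)) @[u --> within `[a, b] x^']
    --> g x + derive_on `[a, b] g x * (x - x).
  apply: cvgD; first exact: cvg_cst.
  apply: cvgM; first exact: dg.
  apply: cvgB; last exact: cvg_cst.
  apply: cvg_within_filter; apply: cvg_within_filter.
  exact: cvg_id.
rewrite subrr mulr0 addr0 in Q.
move/cvgrPdist_lt : Q => /(_ _ e0) H.
have {}H : nbhs x [set u | u != x -> u \in `[a, b] -> `|g x - g u| < e].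
  apply: (@filterS _ (nbhs x) _ _ _ _ H) => u /= {}H ux uab.
  by have := H ux uab; rewrite divfK ?subr_eq0// subrKC.
apply: filterS H => u /= H uab.
by have [->|ux] := eqVneq u x; [rewrite subrr normr0|exact: H].
Qed.

(** At an interior point a small enough increment stays in the interval, so the
relative difference quotient is the ordinary one. *)
Lemma is_derive_on : a < x < b -> is_derive x 1 g (derive_on `[a, b] g x).
Proof.
move=> /andP[ax xb].
suff H : h^-1 *: ((g \o shift x) (h *: 1) - g x) @[h --> 0^'] -->
    derive_on `[a, b] g x.
  by apply: DeriveDef; [apply/cvg_ex; exists (derive_on `[a, b] g x)|exact/cvg_lim].
apply/cvgrPdist_lt => e e0.
move/cvgrPdist_lt : (dg) => /(_ _ e0) H.
have {}H : nbhs x [set u | u != x -> u \in `]a, b[ ->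
    `|derive_on `[a, b] g x - (g u - g x) / (u - x)| < e].
  apply: (@filterS _ (nbhs x) _ _ _ _ H) => u /= {}H ux uab.
  by apply: H => //; exact: subset_itv_oo_cc uab.
have Hab : nbhs x [set u | u \in `]a, b[].
  by apply: near_in_itvoo; rewrite in_itv/= ax.
have : \forall u \near x, u != x ->
    `|derive_on `[a, b] g x - (g u - g x) / (u - x)| < e.
  by apply: filterS2 H Hab => u /= H uab ux; exact: H.
rewrite (near_shift 0) subr0 => H'.
apply: (@filterS _ (nbhs (0 : R)) _ _ _ _ H') => h /= {}H' h0.
rewrite scaler1 /= /GRing.scale/= [_^-1 * _]mulrC.
have := H'; rewrite addrK; apply; apply: contra_neq h0.
by move=> /(canRL (addrK _)); rewrite subrr.
Qed.
End relative_derivative.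

(** The mean value theorem and the fundamental theorem of calculus ask for no
more than this, and it does not involve one-sided derivatives at the end
points. *)
Definition derives_to (R : realType) (l r : R) (g g' : R -> R) : Prop :=
  {within `[l, r], continuous g} /\
  forall u, l < u < r -> is_derive u 1 g (g' u).

Lemma derivable_on_derives_to (R : realType) (a b : R) (g : R -> R) :
  (forall u, a <= u <= b -> derivable_on `[a, b] g u) ->
  derives_to a b g (derive_on `[a, b] g).
Proof.
move=> dg; split.
  apply/subspace_continuousP => u /=; rewrite in_itv/= => uab.
  exact: derivable_on_continuous (dg _ uab).
move=> u /andP[au ub]; apply: is_derive_on; last by rewrite au.
by apply: dg; rewrite !ltW.
Qed.

Lemma derives_toS (R : realType) (a b l r : R) (g g' : R -> R) :
  a <= l -> r <= b -> derives_to a b g g' -> derives_to l r g g'.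
Proof.
move=> al rb [cg dg]; split.
  by apply: continuous_subspaceW cg; apply: subset_itv; rewrite bnd_simp.
by move=> u /andP[lu ur]; apply: dg; rewrite (le_lt_trans al)// (lt_le_trans ur).
Qed.

Lemma derives_toB (R : realType) (l r : R) (g g' h h' : R -> R) :
  derives_to l r g g' -> derives_to l r h h' ->
  derives_to l r (fun u => g u - h u) (fun u => g' u - h' u).
Proof.
move=> [cg dg] [ch dh]; split; first by move=> u; exact: cvgB (cg u) (ch u).
by move=> u ulr; exact: is_deriveB (dg u ulr) (dh u ulr).
Qed.

Lemma derives_to_le (R : realType) (l r : R) (g g' : R -> R) (M u1 u2 : R) :
  derives_to l r g g' -> (forall u, l <= u <= r -> `|g' u| <= M) ->
  l <= u1 <= r -> l <= u2 <= r -> `|g u2 - g u1| <= M * `|u2 - u1|.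
Proof.
move=> dg gM; wlog u12 : u1 u2 / u1 <= u2.
  move=> H u1lr u2lr; have [|/ltW] := leP u1 u2; first by move/H; exact.
  by rewrite distrC [`|u2 - u1|]distrC; move/H; exact.
move=> /andP[lu1 _] /andP[_ u2r].
have [cg {}dg] := derives_toS lu1 u2r dg.
have dg' x : x \in `]u1, u2[ -> is_derive x 1 g (g' x).
  by rewrite in_itv; exact: dg.
have [c cu ->] := MVT_segment u12 dg' cg.
rewrite normrM ler_wpM2r// gM//.
by move: cu; rewrite in_itv/= => /andP[? ?]; apply/andP; split; lra.
Qed.
Lemma derives_to_ext (R : realType) (l r : R) (g g' h h' : R -> R) :
  (forall u, l <= u <= r -> g u = h u) -> (forall u, l < u < r -> g' u = h' u) ->
  derives_to l r g g' -> derives_to l r h h'.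
Proof.
move=> gh gh' [cg dg]; split.
  apply: subspace_eq_continuous cg => u; rewrite inE/= in_itv/=; exact: gh.
move=> u ulr; rewrite -gh'//; apply: near_eq_is_derive (dg _ ulr).
have : \forall v \near u, v \in `]l, r[ by apply: near_in_itvoo; rewrite in_itv.
apply: filterS => v; rewrite in_itv/= => /andP[lv vr].
by apply: gh; rewrite !ltW.
Qed.

Lemma derives_toM (R : realType) (l r : R) (g g' h h' : R -> R) :
  derives_to l r g g' -> derives_to l r h h' ->
  derives_to l r (fun u => g u * h u) (fun u => g u * h' u + h u * g' u).
Proof.
move=> [cg dg] [ch dh]; split; first by move=> u; exact: cvgM (cg u) (ch u).
by move=> u ulr; exact: is_deriveM (dg u ulr) (dh u ulr).
Qed.

Lemma derives_toD (R : realType) (l r : R) (g g' h h' : R -> R) :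
  derives_to l r g g' -> derives_to l r h h' ->
  derives_to l r (fun u => g u + h u) (fun u => g' u + h' u).
Proof.
move=> [cg dg] [ch dh]; split; first by move=> u; exact: cvgD (cg u) (ch u).
by move=> u ulr; exact: is_deriveD (dg u ulr) (dh u ulr).
Qed.

Lemma derives_to_cst (R : realType) (l r k : R) :
  derives_to l r (fun=> k) (fun=> 0).
Proof. by split=> [u|u _]; [exact: cvg_cst|exact: is_derive_cst]. Qed.

Lemma derives_to_id (R : realType) (l r : R) : derives_to l r id (fun=> 1).
Proof.
split=> [|u _]; last exact: is_derive_id.
by apply: continuous_subspaceT => u; exact: cvg_id.
Qed.

Lemma derives_toZ (R : realType) (l r k : R) (g g' : R -> R) :
  derives_to l r g g' -> derives_to l r (fun u => k * g u) (fun u => k * g' u).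
Proof.
move=> dg; apply: derives_to_ext (derives_toM (derives_to_cst l r k) dg) => //.
by move=> u _; rewrite mulr0 addr0.
Qed.

Lemma derives_to_ndecr (R : realType) (l r : R) (g g' : R -> R) : l <= r ->
  derives_to l r g g' -> (forall u, l < u < r -> 0 <= g' u) -> g l <= g r.
Proof.
rewrite le_eqVlt => /predU1P[-> //|lr [cg dg] g'0].
have dg' u : u \in `]l, r[ -> is_derive u 1 g (g' u).
  by rewrite in_itv; exact: dg.
have [c clr gE] := MVT lr dg' cg.
rewrite -subr_ge0 gE mulr_ge0 ?g'0 ?subr_ge0 ?ltW//.
Qed.

(** * Integrals of increments in one variable *)

Lemma continuous_itv_integrable (R : realType) (l r : R) (g : R -> R) :
  {within `[l, r], continuous g} ->
  (@lebesgue_measure R).-integrable `[l, r] (EFin \o g).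
Proof. by apply: continuous_compact_integrable; exact: segment_compact. Qed.

Lemma Rintegral_derives_to (R : realType) (l r : R) (g : R -> R) : l <= r ->
  {within `[l, r], continuous g} ->
  derives_to l r (fun u => \int[lebesgue_measure]_(w in `[l, u]) g w) g.
Proof.
move=> lr cg; have ig := continuous_itv_integrable cg.
split; first exact: parameterized_integral_continuous.
move=> u /andP[lu ur].
have /(continuous_within_itvP _ (lt_trans lu ur))[cgoo _ _] := cg.
have uoo : u \in `]l, r[ by rewrite in_itv/= lu.
have [dF F'] := continuous_FTC1_closed ur ig lu (cgoo _ uoo).
by apply: DeriveDef; [exact: dF|rewrite -derive1E; exact: F'].
Qed.

Lemma Rintegral_itv_cst (R : realType) (l r k : R) : l <= r ->
  \int[lebesgue_measure]_(u in `[l, r]) k = k * (r - l).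
Proof.
move=> lr; rewrite Rintegral_cst//= lebesgue_measure_itv/= lte_fin.
by move: lr; rewrite le_eqVlt => /predU1P[->|->]//; rewrite ltxx subrr.
Qed.

(** A base point [e] and an apex [x] at the two ends, in either order: the four
quadrants differ only in these orientations, and are treated at once. *)
Definition opposite_ends (R : realType) (l r e x : R) : Prop :=
  (e = l /\ x = r) \/ (e = r /\ x = l).

(** Integration by parts in the form of an inequality.  The function
[Psi u = (x - u) (g u - g e) + int_l^u (g - g e)] has derivative
[(x - u) g' u], with no integral of [g'] involved; its first term vanishes at
both ends, so its increment is the integral of [g - g e].  Comparing [Psi] and
[- Psi] with [H] gives the bound. *)
Lemma Rintegral_base_bound (R : realType) (l r e x : R) (g g' H h : R -> R) :
  l <= r -> opposite_ends l r e x ->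
  derives_to l r g g' -> derives_to l r H h ->
  (forall u, l < u < r -> `|(x - u) * g' u| <= h u) ->
  `|\int[lebesgue_measure]_(u in `[l, r]) (g u - g e)| <= H r - H l.
Proof.
move=> lr ex dg dH g'h.
have dge := derives_toB dg (derives_to_cst l r (g e)).
pose F u := \int[lebesgue_measure]_(w in `[l, u]) (g w - g e).
pose Psi u := (x - u) * (g u - g e) + F u.
have dPsi : derives_to l r Psi (fun u => (x - u) * g' u).
  have dx := derives_toB (derives_to_cst l r x) (derives_to_id l r).
  have dF := Rintegral_derives_to lr dge.1.
  apply: derives_to_ext (derives_toD (derives_toM dx dge) dF) => // u _.
  ring.
have F0 : F l = 0 by rewrite /F set_itv1 Rintegral_set1.
have -> : \int[lebesgue_measure]_(u in `[l, r]) (g u - g e) = Psi r - Psi l.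
  rewrite /Psi.
  have [-> ->] : (x - r) * (g r - g e) = 0 /\ (x - l) * (g l - g e) = 0.
    by case: ex => -[-> ->]; rewrite !subrr !(mul0r, mulr0).
  by rewrite F0 addr0 subr0 add0r.
have P1 : H l + Psi l <= H r + Psi r.
  apply: (derives_to_ndecr lr (derives_toD dH dPsi)) => u /g'h.
  by rewrite ler_norml => /andP[? _]; lra.
have P2 : H l - Psi l <= H r - Psi r.
  apply: (derives_to_ndecr lr (derives_toB dH dPsi)) => u /g'h.
  by rewrite ler_norml => /andP[_ ?]; lra.
by rewrite ler_norml; apply/andP; split; lra.
Qed.

(** The absolute value avoids the jump at 0 of [powR], which is 1 on negative
arguments. *)
Lemma continuous_powR_normr (R : realType) (k : R) : 0 < k ->
  continuous (fun t : R => `|t| `^ k).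
Proof.
move=> k0 t; have [->|t0] := eqVneq t 0.
  rewrite /continuous_at normr0 powR0 ?gt_eqF//.
  apply/cvgrPdist_lt => e e0.
  have : \forall z \near nbhs (0 : R), `|0 - z| < e `^ k^-1.
    by apply: (@cvgr_dist_lt _ _ _ _ _ id) => //; rewrite powR_gt0.
  apply: filterS => z; rewrite !sub0r !normrN => ze.
  rewrite ger0_norm ?powR_ge0//.
  have := gt0_ltr_powR k0 _ _ ze; rewrite !nnegrE powR_ge0 normr_ge0.
  by rewrite -powRrM mulVf ?gt_eqF// powRr1 ?ltW//; apply.
apply: (@cvg_comp _ _ _ (fun t : R => `|t|) (fun z => z `^ k) _ (nbhs `|t|)).
  exact: norm_continuous.
have H : {for `|t|, continuous (@powR R ^~ k)}.
  apply/differentiable_continuous/derivable1_diffP/derivable_powR.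
  by rewrite in_itv/= andbT normr_gt0.
exact: H.
Qed.

Lemma derives_to_powR (R : realType) (l r k a b : R) : 0 <= k ->
  (forall u, l <= u <= r -> 0 <= a * u + b) ->
  (forall u, l < u < r -> 0 < a * u + b) ->
  derives_to l r (fun u => (a * u + b) `^ (k + 1))
                 (fun u => (k + 1) * a * (a * u + b) `^ k).
Proof.
move=> k0 ge0 gt0; split.
  have : {within `[l, r], continuous (fun u => `|a * u + b| `^ (k + 1))}.
    apply: continuous_subspaceT => u.
    apply: (continuous_comp (f := fun u => a * u + b)
      (g := fun t => `|t| `^ (k + 1))).
      by apply: cvgD; [apply: cvgM; [exact: cvg_cst|exact: cvg_id]|exact: cvg_cst].
    by apply: continuous_powR_normr; lra.
  move=> cH; apply: subspace_eq_continuous cH => u.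
  rewrite inE/= in_itv/= => /ge0 u0.
  by rewrite /from_subspace ger0_norm.
move=> u ulr.
have dl : is_derive u 1 (fun u => a * u + b) a.
  apply: is_derive_eq.
  by rewrite /GRing.scale/=; ring.
have dp := is_derive1_powR (k + 1) (gt0 _ ulr).
have := @is_derive1_comp _ (fun v => v `^ (k + 1)) (fun u => a * u + b) _ _ _ dp dl.
rewrite addrK => H; apply: is_derive_eq H _.
by rewrite mulrAC.
Qed.
(** The quotient [(x - u) / (x - e)] is the barycentric weight of [e] in [u]: both
orientations give the same formula. *)
Section opposite_ends.
Variables (R : realType) (l r e x : R).
Hypotheses (lr : l < r) (ex : opposite_ends l r e x).

Lemma opposite_ends_neq : x - e != 0.
Proof. by rewrite subr_eq0; case: ex => -[-> ->]; rewrite ?(gt_eqF lr) ?(lt_eqF lr). Qed.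

Lemma opposite_ends_itv : l <= e <= r /\ l <= x <= r.
Proof. by case: ex => -[-> ->]; rewrite !lexx (ltW lr). Qed.

Lemma weight_ge0 u : l <= u <= r -> 0 <= (x - u) / (x - e).
Proof.
move=> /andP[lu ur]; case: ex => -[-> ->]; first by rewrite divr_ge0 ?subr_ge0 ?(ltW lr).
by rewrite -mulrNN -invrN !opprB divr_ge0 ?subr_ge0 ?(ltW lr).
Qed.

Lemma weight_gt0 u : l < u < r -> 0 < (x - u) / (x - e).
Proof.
move=> /andP[lu ur]; case: ex => -[-> ->]; first by rewrite divr_gt0 ?subr_gt0.
by rewrite -mulrNN -invrN !opprB divr_gt0 ?subr_gt0.
Qed.

Lemma normr_weight u : l <= u <= r -> `|x - u| = (r - l) * ((x - u) / (x - e)).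
Proof.
move=> ulr; have -> : r - l = `|x - e|.
  case: ex => -[-> ->]; first by rewrite gtr0_norm ?subr_gt0.
  by rewrite ltr0_norm ?opprB ?subr_lt0.
rewrite -[X in _ * X](ger0_norm (weight_ge0 ulr)) -normrM mulrC divfK//.
exact: opposite_ends_neq.
Qed.

Lemma onem_weight u : 1 - (x - u) / (x - e) = (e - u) / (e - x).
Proof.
have xe := opposite_ends_neq.
have ex0 : e - x != 0 by rewrite -opprB oppr_eq0.
by field; rewrite xe ex0.
Qed.

Lemma derives_to_weight_powR (k : R) : 0 <= k ->
  derives_to l r (fun u => - ((x - e) / (k + 1)) * ((x - u) / (x - e)) `^ (k + 1))
                 (fun u => ((x - u) / (x - e)) `^ k).
Proof.
move=> k0; have xe := opposite_ends_neq.
have tE u : - (x - e)^-1 * u + x / (x - e) = (x - u) / (x - e) by field.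
have k1 : k + 1 != 0 by rewrite gt_eqF//; lra.
have := @derives_to_powR _ l r k (- (x - e)^-1) (x / (x - e)) k0.
move=> /(_ _ _)/(derives_toZ (- ((x - e) / (k + 1)))) H.
apply: derives_to_ext (H _ _).
- by move=> u _; rewrite tE.
- move=> u _; rewrite tE mulrA.
  by rewrite (_ : _ * (_ * _) = 1) ?mul1r//; field; rewrite xe.
- by move=> u ulr; rewrite tE weight_ge0.
- by move=> u ulr; rewrite tE weight_gt0.
Qed.

End opposite_ends.

Lemma opposite_endsC (R : realType) (l r e x : R) :
  opposite_ends l r e x -> opposite_ends l r x e.
Proof. by case=> -[-> ->]; [right|left]. Qed.

(** The shape of the bound is preserved: integrating in one variable a combination
of products of powers of the weights in [u] and in [v] leaves a combination of
powers of the weights in [v], to which the lemma applies again. *)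
Lemma Rintegral_base_powR_bound (R : realType) (l r e x : R) (g g' : R -> R)
    (p s A X Y : R) :
  l < r -> opposite_ends l r e x -> derives_to l r g g' -> 0 <= p -> 0 <= s ->
  (forall u, l < u < r -> (x - u) / (x - e) * `|g' u| <=
     A * ((x - u) / (x - e)) `^ p +
     X * ((x - u) / (x - e)) `^ s + Y * ((e - u) / (e - x)) `^ s) ->
  `|\int[lebesgue_measure]_(u in `[l, r]) (g u - g e)| <=
     (r - l) ^+ 2 * (A / (p + 1) + (X + Y) / (s + 1)).
Proof.
move=> lr ex dg p0 s0 bound.
have xe := opposite_ends_neq lr ex.
have dt k := derives_to_weight_powR lr ex (k := k).
have dt' k := derives_to_weight_powR lr (opposite_endsC ex) (k := k).
have dH := derives_toZ (r - l) (derives_toD (derives_toD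
  (derives_toZ A (dt _ p0)) (derives_toZ X (dt _ s0))) (derives_toZ Y (dt' _ s0))).
have /= := Rintegral_base_bound (ltW lr) ex dg dH.
have p1 : p + 1 != 0 by rewrite gt_eqF//; lra.
have s1 : s + 1 != 0 by rewrite gt_eqF//; lra.
move=> /(_ _)/le_trans; apply.
  move=> u ulr; have /andP[lu ur] := ulr.
  have ulr' : l <= u <= r by rewrite !ltW.
  rewrite normrM (normr_weight lr ex ulr') -mulrA ler_pM2l ?subr_gt0//.
  exact: bound.
rewrite le_eqVlt; apply/orP; left; apply/eqP.
case: ex xe => -[-> ->] xe; rewrite !subrr !mul0r !divff ?powR1 ?powR0 //.
- by field; rewrite ?p1 ?s1.
- by rewrite -opprB oppr_eq0.
- by field; rewrite ?p1 ?s1.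
- by rewrite -opprB oppr_eq0.
Qed.

(** The bound is assumed on an open interval of parameters only, which allows
[f u] to be differentiable merely inside its interval. *)
Lemma is_derive_Rintegral (R : realType) (l r l' r' v : R) (f fv : R -> R -> R)
    (M : R) : l <= r -> l' < v < r' ->
  (forall v, l' < v < r' -> {within `[l, r], continuous f ^~ v}) ->
  (forall u v, l <= u <= r -> l' < v < r' -> is_derive v 1 (f u) (fv u v)) ->
  (forall u v, l <= u <= r -> l' < v < r' -> `|fv u v| <= M) ->
  is_derive v 1 (fun v => \int[lebesgue_measure]_(u in `[l, r]) f u v)
    (\int[lebesgue_measure]_(u in `[l, r]) fv u v).
Proof.
move=> lr v_itv cf df fvM.
have d1E z u : l' < z < r' -> l <= u <= r -> partial1of2 (fun v u => f u v) z u = fv u z.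
  by move=> zI uI; rewrite partial1of2E; have [_ ->] := df u z uI zI.
have intf z : `]l', r'[%classic z ->
    (@lebesgue_measure R).-integrable `[l, r] (EFin \o f ^~ z).
  by rewrite /= in_itv/= => zI; exact/continuous_itv_integrable/cf.
have := @cvg_differentiation_under_integral R _ _ (@lebesgue_measure R)
  (fun v u => f u v) `[l, r] (measurable_itv _) v l' r' _ intf _ (fun=> `|M|) _ _ _.
rewrite /= in_itv/=.
move=> /(_ v_itv) H.
have {H} : h^-1 *: (\int[lebesgue_measure]_(u in `[l, r]) f u (h + v) -
    \int[lebesgue_measure]_(u in `[l, r]) f u v) @[h --> 0^'] -->
    \int[lebesgue_measure]_(u in `[l, r]) fv u v.
  rewrite [X in _ --> X](_ : _ = \int[lebesgue_measure]_(u in `[l, r])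
    (partial1of2 (fun v u => f u v) v u)).
    apply: H => //.
    - move=> z u; rewrite in_itv/= => zI uI.
      by have [] := df u z _ zI; rewrite // in uI.
    - exact: continuous_itv_integrable (fun=> cvg_cst _).
    - move=> z u zI uI; rewrite d1E//.
        rewrite (le_trans (fvM _ _ _ _)) ?ler_norm//.
  apply: eq_Rintegral => u; rewrite inE/= in_itv/= => uI.
  by rewrite d1E.
move=> H.
have E : (fun h : R => h^-1 *: (((fun v => \int[lebesgue_measure]_(u in `[l, r]) f u v)
    \o shift v) (h *: 1) - \int[lebesgue_measure]_(u in `[l, r]) f u v)) =
  (fun h => h^-1 *: (\int[lebesgue_measure]_(u in `[l, r]) f u (h + v) -
    \int[lebesgue_measure]_(u in `[l, r]) f u v)).
  by apply/funext => h /=; rewrite scaler1.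
apply: DeriveDef.
  by apply/cvg_ex; eexists; rewrite E; exact: H.
by apply/cvg_lim => //; rewrite E; exact: H.
Qed.
(** * Integrals of mixed increments over a rectangle *)

(** [fv] plays the partial derivative of [f] in the second variable and [w] that
of [fv] in the first one, in agreement with the order of differentiation in
[mixed_partial]. *)
Definition mixed_derives (R : realType) (l r l' r' : R) (f fv w : R -> R -> R)
    (M : R) : Prop :=
  [/\ forall v, l' <= v <= r' -> {within `[l, r], continuous f ^~ v},
      forall u, l <= u <= r -> derives_to l' r' (f u) (fv u),
      forall v, l' <= v <= r' -> derives_to l r (fv ^~ v) (w ^~ v) &
      forall u v, l <= u <= r -> l' <= v <= r' -> `|w u v| <= M].

Lemma mixed_derivesS (R : realType) (a b c d l r l' r' : R)
    (f fv w : R -> R -> R) (M : R) :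
  a <= l -> r <= b -> c <= l' -> r' <= d ->
  mixed_derives a b c d f fv w M -> mixed_derives l r l' r' f fv w M.
Proof.
move=> al rb cl' r'd [cf df dfv wM].
have uI u : l <= u <= r -> a <= u <= b by move=> /andP[? ?]; apply/andP; split; lra.
have vI v : l' <= v <= r' -> c <= v <= d by move=> /andP[? ?]; apply/andP; split; lra.
split.
- move=> v /vI/cf; apply: continuous_subspaceW.
  by apply: subset_itv; rewrite bnd_simp.
- by move=> u /uI/df; exact: derives_toS.
- by move=> v /vI/dfv; exact: derives_toS.
- by move=> u v /uI ? /vI ?; exact: wM.
Qed.

Lemma lipschitz_itv_continuous (R : realType) (l r k : R) (g : R -> R) :
  (forall u v, l <= u <= r -> l <= v <= r -> `|g v - g u| <= k * `|v - u|) ->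
  {within `[l, r], continuous g}.
Proof.
move=> gk; apply/subspace_continuousP => u /=; rewrite in_itv/= => uI.
apply/cvgrPdist_lt => e e0.
have : \forall v \near u, `|u - v| < e / (`|k| + 1).
  by apply: nbhsx_ballx; rewrite divr_gt0// ltr_wpDl.
apply: filterS => v uv; rewrite /= in_itv/= => vI.
apply: (le_lt_trans (gk _ _ vI uI)).
have k1 : 0 < `|k| + 1 by rewrite ltr_wpDl.
move: uv; rewrite ltr_pdivlMr// => /le_lt_trans; apply.
rewrite mulrC ler_wpM2l// (le_trans (ler_norm k))//.
by rewrite lerDl.
Qed.

Lemma le_normr_Rintegral_itv (R : realType) (l r k : R) (g : R -> R) : l <= r ->
  {within `[l, r], continuous g} -> (forall u, l <= u <= r -> `|g u| <= k) ->
  `|\int[lebesgue_measure]_(u in `[l, r]) g u| <= k * (r - l).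
Proof.
move=> lr cg gk; have ig := continuous_itv_integrable cg.
rewrite (le_trans (le_normr_Rintegral _ ig))// -Rintegral_itv_cst//.
apply: le_Rintegral => //.
- by apply: continuous_itv_integrable => u; exact: cvg_norm (cg u).
- by apply: continuous_itv_integrable => u; exact: cvg_cst.
Qed.

Section mixed_derives.
Variables (R : realType) (l r l' r' : R) (f fv w : R -> R -> R) (M : R).
Hypotheses (lr : l <= r) (lr' : l' <= r').
Hypothesis dfw : mixed_derives l r l' r' f fv w M.

(** The mean value inequality, first for [f u2 - f u1] in the second variable and
then for [fv] in the first one. *)
Lemma mixed_increment_le u1 u2 v1 v2 : l <= u1 <= r -> l <= u2 <= r ->
  l' <= v1 <= r' -> l' <= v2 <= r' ->
  `|f u2 v2 - f u1 v2 - (f u2 v1 - f u1 v1)| <= M * `|u2 - u1| * `|v2 - v1|.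
Proof.
case: dfw => cf df dfv wM u1I u2I v1I v2I.
apply: (derives_to_le (derives_toB (df _ u2I) (df _ u1I))) => // v vI.
by apply: (derives_to_le (dfv _ vI)) => // u uI; exact: wM.
Qed.

Lemma mixed_bound_ge0 : 0 <= M.
Proof.
case: dfw => _ _ _ wM; apply: le_trans (wM l l' _ _); by rewrite ?lexx.
Qed.

Lemma continuous_Rintegral_increment e : l <= e <= r ->
  {within `[l', r'], continuous
    (fun v => \int[lebesgue_measure]_(u in `[l, r]) (f u v - f e v))}.
Proof.
move=> eI; have [cf _ _ _] := dfw.
have cfe v : l' <= v <= r' -> {within `[l, r], continuous (fun u => f u v - f e v)}.
  by move=> /cf + u => /(_ u) cfu; exact: cvgB cfu (cvg_cst _).
apply: (@lipschitz_itv_continuous _ _ _ (M * (r - l) * (r - l))) => v1 v2 v1I v2I.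
rewrite -RintegralB//; last 2 first.
- exact: continuous_itv_integrable (cfe _ v2I).
- exact: continuous_itv_integrable (cfe _ v1I).
rewrite mulrAC; apply: le_normr_Rintegral_itv => // [u|u uI].
  exact: cvgB (cfe _ v2I u) (cfe _ v1I u).
apply: (le_trans (mixed_increment_le eI uI v1I v2I)).
rewrite ler_wpM2r// ler_wpM2l ?mixed_bound_ge0//.
by rewrite ler_norml; move: eI uI => /andP[? ?] /andP[? ?]; apply/andP; split; lra.
Qed.

(** Only mixed increments of [f] are Lipschitz, so the integral of [f] itself is
recovered from that of [f u v - f l v] and the slice [f l]. *)
Lemma continuous_Rintegral1 :
  {within `[l', r'], continuous (fun v => \int[lebesgue_measure]_(u in `[l, r]) f u v)}.
Proof.
have [cf df _ _] := dfw.
have lI : l <= l <= r by rewrite lexx.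
have H : {within `[l', r'], continuous (fun v =>
    \int[lebesgue_measure]_(u in `[l, r]) (f u v - f l v) + f l v * (r - l))}.
  move=> v; apply: cvgD; first exact: continuous_Rintegral_increment.
  by apply: cvgM; [exact: (df _ lI).1|exact: cvg_cst].
apply: subspace_eq_continuous H => v; rewrite inE/= in_itv/= => vI.
rewrite /from_subspace RintegralB//.
- by rewrite Rintegral_itv_cst// subrK.
- exact: continuous_itv_integrable (cf _ vI).
- by apply: continuous_itv_integrable => u; exact: cvg_cst.
Qed.

Lemma derives_to_Rintegral_increment e : l <= e <= r ->
  derives_to l' r'
    (fun v => \int[lebesgue_measure]_(u in `[l, r]) (f u v - f e v))
    (fun v => \int[lebesgue_measure]_(u in `[l, r]) (fv u v - fv e v)).
Proof.
move=> eI; split; first exact: continuous_Rintegral_increment.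
have [cf df dfv wM] := dfw.
have ooI v : l' < v < r' -> l' <= v <= r' by move=> /andP[? ?]; rewrite !ltW.
move=> v vI.
apply: (@is_derive_Rintegral _ _ _ l' r' _ (fun u v => f u v - f e v)
  (fun u v => fv u v - fv e v) (M * (r - l))) => //.
- by move=> z /ooI/cf + u => /(_ u) cfu; exact: cvgB cfu (cvg_cst _).
- by move=> u z uI zI; have [_ d] := derives_toB (df _ uI) (df _ eI); exact: d.
- move=> u z uI /ooI zI.
  have := derives_to_le (dfv _ zI) (fun u uI => wM u z uI zI) eI uI.
  move=> /le_trans; apply; rewrite ler_wpM2l ?mixed_bound_ge0//.
  by rewrite ler_norml; move: eI uI => /andP[? ?] /andP[? ?]; apply/andP; split; lra.
Qed.

End mixed_derives.

(** Two applications of the one-variable bound.  For fixed [v] the first one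
bounds the derivative in [v] of the inner integral [k], multiplied by the weight
[la] of [v]; this is the hypothesis of the second one, applied to [k]. *)
Lemma quadrant_powR_bound (R : realType) (l r l' r' e x e' y : R)
    (f fv w : R -> R -> R) (M p s A Bee Bey Bxe Bxy : R) :
  l < r -> l' < r' -> opposite_ends l r e x -> opposite_ends l' r' e' y ->
  mixed_derives l r l' r' f fv w M -> 0 <= p -> 0 <= s ->
  (forall u v, l < u < r -> l' < v < r' ->
    (x - u) / (x - e) * ((y - v) / (y - e')) * `|w u v| <=
    A * ((x - u) / (x - e)) `^ p * ((y - v) / (y - e')) `^ p +
    ((x - u) / (x - e)) `^ s * (((y - v) / (y - e')) `^ s * Bee +
                                ((e' - v) / (e' - y)) `^ s * Bey) +
    ((e - u) / (e - x)) `^ s * (((y - v) / (y - e')) `^ s * Bxe +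
                                ((e' - v) / (e' - y)) `^ s * Bxy)) ->
  `|\int[lebesgue_measure]_(v in `[l', r'])
      \int[lebesgue_measure]_(u in `[l, r]) (f u v - f e v - (f u e' - f e e'))|
  <= (r - l) ^+ 2 * (r' - l') ^+ 2 *
     (A / (p + 1) ^+ 2 + (Bee + Bey + Bxe + Bxy) / (s + 1) ^+ 2).
Proof.
move=> lr lr' ex ex' dfw p0 s0 bound.
have [eI xI] := opposite_ends_itv lr ex.
have [e'I yI] := opposite_ends_itv lr' ex'.
have dk := derives_to_Rintegral_increment (ltW lr) (ltW lr') dfw eI.
have [cf df dfv wM] := dfw.
have ife v : l' <= v <= r' -> (@lebesgue_measure R).-integrable `[l, r]
    (EFin \o (fun u => f u v - f e v)).
  move=> /cf cfv; apply: continuous_itv_integrable => u.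
  exact: cvgB (cfv u) (cvg_cst _).
pose k v := \int[lebesgue_measure]_(u in `[l, r]) (f u v - f e v).
rewrite [X in `|X|](_ : _ =
    \int[lebesgue_measure]_(v in `[l', r']) (k v - k e')); last first.
  apply: eq_Rintegral => v; rewrite inE/= in_itv/= => vI.
  by rewrite /k -RintegralB//; exact: ife.
have p1 : p + 1 != 0 by rewrite gt_eqF//; lra.
have s1 : s + 1 != 0 by rewrite gt_eqF//; lra.
pose L := (r - l) ^+ 2.
have := @Rintegral_base_powR_bound _ l' r' e' y k _ p s (L * (A / (p + 1)))
  (L * ((Bee + Bxe) / (s + 1))) (L * ((Bey + Bxy) / (s + 1))) lr' ex' dk p0 s0.
move=> /(_ _)/le_trans; apply; last first.
  by rewrite le_eqVlt; apply/orP; left; apply/eqP; rewrite /L; field; rewrite p1 s1.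
move=> v vI.
have vI' : l' <= v <= r' by move: vI => /andP[? ?]; rewrite !ltW.
set la := (y - v) / _; set la' := (e' - v) / _.
have la0 : 0 < la by exact: (weight_gt0 lr' ex').
have := @Rintegral_base_powR_bound _ l r e x (fun u => la * fv u v) _ p s
  (A * la `^ p) (la `^ s * Bee + la' `^ s * Bey) (la `^ s * Bxe + la' `^ s * Bxy)
  lr ex (derives_toZ la (dfv _ vI')) p0 s0.
rewrite (_ : \int[lebesgue_measure]_(u in `[l, r]) (la * fv u v - la * fv e v) =
   la * \int[lebesgue_measure]_(u in `[l, r]) (fv u v - fv e v)); last first.
  rewrite -RintegralZl//; last first.
    apply: continuous_itv_integrable => u.
    exact: cvgB ((dfv _ vI').1 u) (cvg_cst _).
  by apply: eq_Rintegral => u _; rewrite mulrBr.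
rewrite normrM gtr0_norm// => /(_ _)/le_trans; apply.
  move=> u uI; rewrite normrM gtr0_norm// mulrA.
  apply: (le_trans (bound _ _ uI vI)).
  by rewrite le_eqVlt; apply/orP; left; apply/eqP; rewrite -/la -/la'; ring.
by rewrite le_eqVlt; apply/orP; left; apply/eqP; rewrite /L; field; rewrite p1 s1.
Qed.
(** * Exchanging integrals of continuous functions *)

(** An open set is the union, over rational intervals [U], of the products of [U]
with the interior of the set of those [v] for which [U * {v}] lies in it: only one
factor has to be enumerated. *)
Lemma open_prod_measurable (R : realType)
    (O : set (measurableTypeR R * measurableTypeR R)) :
  open (O : set (R * R)) -> measurable O.
Proof.
move=> oO.
pose V (q : rat * rat) : set R :=
  interior [set v | forall u : R, ratr q.1 < u < ratr q.2 -> O (u, v)].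
have -> : O = \bigcup_q (`]ratr q.1, ratr q.2[%classic `*` V q).
  apply/seteqP; split=> [[u v] Ouv|[u v] [q _ [/= + /interior_subset/= Vv]]].
    have [[A B] /= [Au Bv] ABO] : nbhs (u, v) (O : set (R * R)) by exact: open_nbhs_nbhs.
    move: Au => /nbhs_ballP[e /= e0 eA].
    have /rat_in_itvoo[q1] : u - e < u by lra.
    have /rat_in_itvoo[q2] : u < u + e by lra.
    rewrite !in_itv/= => /andP[uq2 q2e] /andP[eq1 q1u].
    exists (q1, q2) => //; split; first by rewrite /= in_itv/= q1u.
    apply: filterS Bv => z Bz w /= /andP[q1w wq2].
    apply: ABO; split=> //=; apply: eA; rewrite /ball/= ltr_norml.
    by apply/andP; split; lra.
  by rewrite in_itv/=; exact: Vv.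
apply: countable_bigcupT_measurable => // q.
apply: measurableX; first exact: measurable_itv.
by apply: open_measurable; exact: open_interior.
Qed.

Lemma within_continuous_prod_measurable (R : realType)
    (D : set (measurableTypeR R * measurableTypeR R)) (f : R * R -> R) :
  measurable D -> {within (D : set (R * R)), continuous f} ->
  measurable_fun D (f : measurableTypeR R * measurableTypeR R -> measurableTypeR R).
Proof.
move=> mD /continuousP cf; apply: (measurability _ (RGenOpens.measurableE R)).
move=> _ [_ [a [b ->] <-]].
have /open_subspaceP[U oU UD] : open ((f : subspace (D : set (R * R)) -> R) @^-1`
    `]a, b[%classic).
  by apply: cf; exact: interval_open.
rewrite setIC -UD; apply: measurableI => //; exact: open_prod_measurable.
Qed.

Lemma continuous_slices (R : realType) (a b c d : R) (f : R -> R -> R) :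
  {within rectangle a b c d, continuous (fun z => f z.1 z.2)} ->
  (forall u, a <= u <= b -> {within `[c, d], continuous f u}) /\
  (forall v, c <= v <= d -> {within `[a, b], continuous f ^~ v}).
Proof.
move=> /subspace_continuousP cf; split=> [u uI|v vI].
  apply/subspace_continuousP => v /= vI.
  have cp : {for v, continuous (fun w : R => (u, w))}.
    move=> P [[A B] /= [Au Bv] ABP]; apply: filterS Bv => w Bw.
    by apply: ABP; split=> //=; exact: nbhs_singleton Au.
  have Duv : rectangle a b c d (u, v) by split=> //=; rewrite in_itv.
  move=> P /(cf _ Duv) /cp H.
  apply: (@filterS _ (nbhs v) _ _ _ _ H) => w /= {}H wI.
  by apply: H; split=> //=; rewrite in_itv.
apply/subspace_continuousP => u /= uI.
have cp : {for u, continuous (fun w : R => (w, v))}.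
  move=> P [[A B] /= [Au Bv] ABP]; apply: filterS Au => w Aw.
  by apply: ABP; split=> //=; exact: nbhs_singleton Bv.
have Duv : rectangle a b c d (u, v) by split=> //=; rewrite in_itv.
move=> P /(cf _ Duv) /cp H.
apply: (@filterS _ (nbhs u) _ _ _ _ H) => w /= {}H wI.
by apply: H; split=> //=; rewrite in_itv.
Qed.

(** Fubini for the extension of [f] by zero, which is bounded and measurable for
the product sigma-algebra. *)
Lemma Rintegral_exchange (R : realType) (a b c d : R) (f : R -> R -> R) :
  {within rectangle a b c d, continuous (fun z => f z.1 z.2)} ->
  \int[lebesgue_measure]_(u in `[a, b]) \int[lebesgue_measure]_(v in `[c, d]) f u v =
  \int[lebesgue_measure]_(v in `[c, d]) \int[lebesgue_measure]_(u in `[a, b]) f u v.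
Proof.
move=> cf; set mu := @lebesgue_measure R.
have [cf1 cf2] := continuous_slices cf.
pose D : set (measurableTypeR R * measurableTypeR R) := rectangle a b c d.
have mD : measurable D by apply: measurableX; exact: measurable_itv.
pose F : measurableTypeR R * measurableTypeR R -> \bar R :=
  (fun z => (f z.1 z.2)%:E) \_ D.
have iF : (mu \x mu)%E.-integrable setT F.
  apply/(integrable_mkcond _ mD).1.
  apply: (measurable_bounded_integrable mD).
  - apply: (@le_lt_trans _ _ (mu `[a, b]%classic * mu `[c, d]%classic)%E).
      by rewrite le_eqVlt; apply/orP; left; apply/eqP; exact: product_measure1E.
    rewrite {1}/mu lebesgue_measure_itv {1}/mu lebesgue_measure_itv/=.
    by do 2 case: ifP => _; rewrite ?mule0 ?mul0e ?ltry// -EFinM ltry.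
  - exact: within_continuous_prod_measurable.
  - have cR : compact (rectangle a b c d : set (R * R)).
      by apply: compact_setX; exact: segment_compact.
    have [M [Mr MB]] := compact_bounded (continuous_compact cf cR).
    by exists M; split=> // x Mx z Dz; apply: (MB _ Mx); exists z.
have FE u v : F (u, v) =
    if (u \in `[a, b]) && (v \in `[c, d]) then (f u v)%:E else 0%E.
  by rewrite /F patchE /D /rectangle in_setX/= !mem_setE.
have Fuv := Fubini iF.
have H1 : (\int[mu]_u \int[mu]_v F (u, v) =
  \int[mu]_(u in `[a, b]) (\int[mu]_(v in `[c, d]) f u v)%:E)%E.
  rewrite [RHS]integral_mkcond; apply: eq_integral => u _.
  rewrite patchE mem_setE; case: ifPn => uI.
    rewrite fineK; last first.
      by apply: integrable_fin_num => //; exact/continuous_itv_integrable/cf1.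
    rewrite [RHS]integral_mkcond; apply: eq_integral => v _.
    by rewrite FE uI patchE mem_setE.
  by rewrite integral0_eq// => v _; rewrite FE (negbTE uI).
have H2 : (\int[mu]_v \int[mu]_u F (u, v) =
  \int[mu]_(v in `[c, d]) (\int[mu]_(u in `[a, b]) f u v)%:E)%E.
  rewrite [RHS]integral_mkcond; apply: eq_integral => v _.
  rewrite patchE mem_setE; case: ifPn => vI.
    rewrite fineK; last first.
      by apply: integrable_fin_num => //; exact/continuous_itv_integrable/cf2.
    rewrite [RHS]integral_mkcond; apply: eq_integral => u _.
    by rewrite FE vI andbT patchE mem_setE.
  by rewrite integral0_eq// => u _; rewrite FE (negbTE vI) andbF.
by rewrite {1}/Rintegral -H1 Fuv H2.
Qed.

(** Near [(u, v)] the function is the sum of two slices, which are continuous, and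
of a mixed increment, which is Lipschitz. *)
Lemma mixed_derives_continuous (R : realType) (l r l' r' : R)
    (f fv w : R -> R -> R) (M : R) : l <= r -> l' <= r' ->
  mixed_derives l r l' r' f fv w M ->
  {within rectangle l r l' r', continuous (fun z => f z.1 z.2)}.
Proof.
move=> lr lr' dfw; have [cf df _ _] := dfw.
apply/subspace_continuousP => -[u v] [/= uI vI].
pose G := within (rectangle l r l' r') (nbhs (u, v)).
have Gfst : z.1 @[z --> G] --> within `[l, r] (nbhs u).
  move=> P uP; exists ([set x : R | x \in `[l, r] -> P x], setT).
    by split=> //=; exact: filterT.
  by move=> z [/= + _] [zI _]; exact.
have Gsnd : z.2 @[z --> G] --> within `[l', r'] (nbhs v).
  move=> P vP; exists (setT, [set x : R | x \in `[l', r'] -> P x]).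
    by split=> //=; exact: filterT.
  by move=> z [/= _ +] [_ zI]; exact.
have c1 : f z.1 v @[z --> G] --> f u v.
  apply: (@cvg_comp _ _ _ (fun z : R * R => z.1) (fun x => f x v) G _ _ Gfst).
  by move/subspace_continuousP: (cf _ vI); exact.
have c2 : f u z.2 @[z --> G] --> f u v.
  apply: (@cvg_comp _ _ _ (fun z : R * R => z.2) (f u) G _ _ Gsnd).
  by move/subspace_continuousP: (df _ uI).1; exact.
have c3 : (f z.1 z.2 - f u z.2 - (f z.1 v - f u v)) @[z --> G] -->
    f u v - f u v - (f u v - f u v).
  rewrite !subrr; apply: norm_cvg0.
  have : (M * `|z.1 - u| * `|z.2 - v|) @[z --> G] --> M * `|u - u| * `|v - v|.
    apply: cvgM; first (apply: cvgM; first exact: cvg_cst).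
      apply: cvg_norm; apply: cvgB; last exact: cvg_cst.
      by apply: cvg_trans Gfst _; exact: cvg_within.
    apply: cvg_norm; apply: cvgB; last exact: cvg_cst.
    by apply: cvg_trans Gsnd _; exact: cvg_within.
  rewrite !subrr normr0 !mulr0 => cM.
  apply: (squeeze_cvgr _ (cvg_cst 0) cM).
  exists (setT, setT); first by split; exact: filterT.
  move=> z _ [z1 z2]; rewrite normr_ge0/=.
  by apply: (mixed_increment_le dfw).
rewrite (_ : (fun z => f z.1 z.2) = (fun z =>
    f z.1 z.2 - f u z.2 - (f z.1 v - f u v) + (f z.1 v + f u z.2) - f u v));
  last by apply/funext => z; ring.
exact: cvgB (cvgD c3 (cvgD c1 c2)) (cvg_cst (f u v)).
Qed.
(** * Co-ordinated s-convexity and the bound on one quadrant *)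

Lemma s_convex2_weight (R : realType) (s l r e x u : R) (g : R -> R) :
  l < r -> opposite_ends l r e x -> s_convex2 s `[l, r] g -> l <= u <= r ->
  g u <= ((x - u) / (x - e)) `^ s * g e + ((e - u) / (e - x)) `^ s * g x.
Proof.
move=> lr ex gs uI; have [eI xI] := opposite_ends_itv lr ex.
have xe := opposite_ends_neq lr ex.
have t0 := weight_ge0 lr ex uI.
have t1 := weight_ge0 lr (opposite_endsC ex) uI.
rewrite -(onem_weight lr ex) in t1 *.
rewrite {1}(_ : u = (x - u) / (x - e) * e + (1 - (x - u) / (x - e)) * x); last by field.
apply: gs; rewrite /= ?in_itv//= t0/=; lra.
Qed.

Lemma coord_s_convex2S (R : realType) (s a b c d l r l' r' : R) (g : R -> R -> R) :
  a <= l -> r <= b -> c <= l' -> r' <= d ->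
  coord_s_convex2 s a b c d g -> coord_s_convex2 s l r l' r' g.
Proof.
move=> al rb cl' r'd [g1 g2].
have S1 : `[l, r] `<=` `[a, b] by apply: subset_itv; rewrite bnd_simp.
have S2 : `[l', r'] `<=` `[c, d] by apply: subset_itv; rewrite bnd_simp.
split=> [v /S2 vI|u /S1 uI] z1 z2 mu.
- by move=> /S1 ? /S1 ?; exact: g1.
- by move=> /S2 ? /S2 ?; exact: g2.
Qed.

(** Convexity in the first variable moves [u] to the two vertical sides, and
convexity in the second one then moves [v] to the vertices. *)
Lemma coord_s_convex2_corners (R : realType) (s l r l' r' e x e' y u v : R)
    (g : R -> R -> R) :
  l < r -> l' < r' -> opposite_ends l r e x -> opposite_ends l' r' e' y ->
  coord_s_convex2 s l r l' r' g -> l <= u <= r -> l' <= v <= r' ->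
  g u v <= ((x - u) / (x - e)) `^ s * (((y - v) / (y - e')) `^ s * g e e' +
                                       ((e' - v) / (e' - y)) `^ s * g e y) +
           ((e - u) / (e - x)) `^ s * (((y - v) / (y - e')) `^ s * g x e' +
                                       ((e' - v) / (e' - y)) `^ s * g x y).
Proof.
move=> lr lr' ex ex' [g1 g2] uI vI.
have [eI xI] := opposite_ends_itv lr ex.
apply: (le_trans (s_convex2_weight lr ex (g1 v _) uI)); first by rewrite /= in_itv.
apply: lerD; rewrite ler_wpM2l ?powR_ge0//; apply: (s_convex2_weight lr' ex' (g2 _ _) vI);
  by rewrite /= in_itv.
Qed.

Lemma coord_s_convex2_bounded (R : realType) (s a b c d u v : R)
    (g : R -> R -> R) : 0 < s -> a < b -> c < d ->
  (forall u v, 0 <= g u v) -> coord_s_convex2 s a b c d g ->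
  a <= u <= b -> c <= v <= d -> g u v <= g a c + g a d + g b c + g b d.
Proof.
move=> s0 ab cd g0 gs uI vI.
have ex : opposite_ends a b a b by left.
have ex' : opposite_ends c d c d by left.
have le1 l r e x w : l < r -> opposite_ends l r e x -> l <= w <= r ->
    ((x - w) / (x - e)) `^ s <= 1.
  move=> lr ends wI.
  have t1 : (x - w) / (x - e) <= 1.
    rewrite -subr_ge0 (onem_weight lr ends).
    exact: (weight_ge0 lr (opposite_endsC ends) wI).
  have one : 1 `^ s = 1 by rewrite powR1.
  rewrite -[leRHS]one; apply: (ge0_ler_powR (ltW s0)) => //.
  - by rewrite nnegrE (weight_ge0 lr ends).
  - by rewrite nnegrE.
have H := coord_s_convex2_corners ab cd ex ex' gs uI vI.
apply: (le_trans H).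
have M1 t z z' : 0 <= t <= 1 -> 0 <= z -> z <= z' -> t * z <= z'.
  by move=> /andP[t0 t1] z0; apply: le_trans; rewrite ler_piMl.
have tI : 0 <= ((b - u) / (b - a)) `^ s <= 1 by rewrite powR_ge0 (le1 a b).
have tI' : 0 <= ((a - u) / (a - b)) `^ s <= 1.
  by rewrite powR_ge0 (le1 a b)//; right.
have laI : 0 <= ((d - v) / (d - c)) `^ s <= 1 by rewrite powR_ge0 (le1 c d).
have laI' : 0 <= ((c - v) / (c - d)) `^ s <= 1.
  by rewrite powR_ge0 (le1 c d)//; right.
rewrite -[leRHS]addrA; apply: lerD; apply: (M1) => //.
- by rewrite addr_ge0// mulr_ge0 ?powR_ge0.
- by apply: lerD; apply: (M1).
- by rewrite addr_ge0// mulr_ge0 ?powR_ge0.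
- by apply: lerD; apply: (M1).
Qed.

(** The product of powers is attained at the [tau] that makes [tau^p P] and
[tau^(- q) Z] equal; both are then the product, and the weights [1 / p] and
[1 / q] add up to 1.  For [Z = 0] there is no best [tau], and [tau] tends to 0. *)
Lemma young_optimum (R : realType) (p q P Z Q : R) :
  0 < p -> 0 < q -> p^-1 + q^-1 = 1 -> 0 < P -> 0 <= Z ->
  (forall tau, 0 < tau -> Q <= tau `^ p * P / p + tau^-1 `^ q * Z / q) ->
  Q <= P `^ p^-1 * Z `^ q^-1.
Proof.
move=> p0 q0 pq P0; have pN0 := lt0r_neq0 p0; have qN0 := lt0r_neq0 q0.
rewrite le_eqVlt => /predU1P[<- H|Z0 H].
  rewrite powR0 ?invr_eq0// mulr0; apply/ler_addgt0Pr => z z0; rewrite add0r.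
  have h0 : 0 < z * p / P by rewrite divr_gt0 ?mulr_gt0.
  have := H ((z * p / P) `^ p^-1); rewrite powR_gt0// => /(_ isT).
  rewrite mulr0 mul0r addr0 -powRrM mulVf// powRr1 ?(ltW h0)// divfK ?mulfK//.
  by rewrite gt_eqF.
set al := P `^ p^-1; set be := Z `^ q^-1.
have al0 : 0 < al by rewrite powR_gt0.
have be0 : 0 < be by rewrite powR_gt0.
have PE : P = al `^ p by rewrite -powRrM mulVf// powRr1// ltW.
have ZE : Z = be `^ q by rewrite -powRrM mulVf// powRr1// ltW.
have split_exp z : 0 < z -> z `^ p^-1 * z `^ q^-1 = z.
  by move=> z0; rewrite -powRD pq ?oner_eq0// powRr1// ltW.
clearbody al be.
have alN0 : al `^ q^-1 != 0 by rewrite gt_eqF// powR_gt0.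
have beN0 : be `^ p^-1 != 0 by rewrite gt_eqF// powR_gt0.
pose tau := be `^ p^-1 / al `^ q^-1.
have tau0 : 0 < tau by rewrite divr_gt0// powR_gt0.
have E1 : tau `^ p * P = al * be.
  have tE : tau * al = (be * al) `^ p^-1.
    by rewrite powRM ?(ltW al0) ?(ltW be0)// -{1}(split_exp _ al0) /tau; field.
  rewrite PE -powRM ?(ltW tau0) ?(ltW al0)// tE -powRrM mulVf// powRr1 1?mulrC//.
  by rewrite mulr_ge0 ?(ltW al0) ?(ltW be0).
have E2 : tau^-1 `^ q * Z = al * be.
  have tE : tau^-1 * be = (al * be) `^ q^-1.
    rewrite powRM ?(ltW al0) ?(ltW be0)// -{1}(split_exp _ be0) /tau; field.
    by rewrite alN0 beN0.
  rewrite ZE -powRM ?(ltW be0) ?invr_ge0 ?(ltW tau0)// tE -powRrM mulVf// powRr1//.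
  by rewrite mulr_ge0 ?(ltW al0) ?(ltW be0).
have := H _ tau0; rewrite E1 E2 -mulrDr pq mulr1; exact.
Qed.

Lemma powR_invsqr (R : realType) (z k : R) : 0 <= z ->
  (z ^+ 2)^-1 `^ k = (z `^ (2 * k))^-1.
Proof.
by move=> z0; rewrite -powR_mulrn// -powRN -powRrM mulNr powRN.
Qed.

(** Hoelder for [t la] and [w] on the quadrant, in the guise of the Young
inequality with an arbitrary parameter. *)
Lemma quadrant_bound (R : realType) (l r l' r' e x e' y : R)
    (f fv w : R -> R -> R) (M p q s : R) :
  l <= r -> l' <= r' -> opposite_ends l r e x -> opposite_ends l' r' e' y ->
  mixed_derives l r l' r' f fv w M ->
  0 < p -> 0 < q -> p^-1 + q^-1 = 1 -> 0 < s ->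
  coord_s_convex2 s l r l' r' (fun u v => `|w u v| `^ q) ->
  `|\int[lebesgue_measure]_(v in `[l', r'])
      \int[lebesgue_measure]_(u in `[l, r]) (f u v - f e v - (f u e' - f e e'))|
  <= (r - l) ^+ 2 * (r' - l') ^+ 2 *
     (((p + 1) `^ (2 / p))^-1 * ((s + 1) `^ (2 / q))^-1 *
     (`|w x y| `^ q + `|w x e'| `^ q + `|w e y| `^ q + `|w e e'| `^ q) `^ q^-1).
Proof.
rewrite le_eqVlt => /predU1P[<- _ _ _ _ _ _ _ _ _|lr].
  rewrite set_itv1; under eq_Rintegral do rewrite Rintegral_set1.
  by rewrite /Rintegral integral0 normr0 subrr expr0n/= !mul0r.
rewrite le_eqVlt => /predU1P[<- _ _ _ _ _ _ _ _|lr'].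
  by rewrite set_itv1 Rintegral_set1 normr0 subrr expr0n/= mulr0 !mul0r.
move=> ex ex' dfw p0 q0 pq s0 conv.
set I := Rintegral _ _ _; set S := _ + _ + _ + _.
have S0 : 0 <= S by rewrite !addr_ge0 ?powR_ge0.
pose L := (r - l) ^+ 2 * (r' - l') ^+ 2.
have L0 : 0 < L by rewrite mulr_gt0 ?exprn_gt0 ?subr_gt0.
have pN0 := lt0r_neq0 p0; have qN0 := lt0r_neq0 q0.
have p1 : 0 < p + 1 by lra.
have s1 : 0 < s + 1 by lra.
rewrite -/L -ler_pdivrMl//.
have := @young_optimum _ p q ((p + 1) ^+ 2)^-1 (((s + 1) ^+ 2)^-1 * S) (L^-1 * `|I|)
  p0 q0 pq.
rewrite invr_gt0 exprn_gt0// mulr_ge0 ?invr_ge0 ?exprn_ge0 ?(ltW s1)//.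
rewrite powRM ?invr_ge0 ?exprn_ge0 ?(ltW s1)// !powR_invsqr ?(ltW s1) ?(ltW p1)//.
rewrite -mulrA; apply=> // tau tau0.
have tauN0 := lt0r_neq0 tau0.
pose B (z : R) : R := tau^-1 `^ q / q * (`|z| `^ q).
have := @quadrant_powR_bound _ l r l' r' e x e' y f fv w M p s (tau `^ p / p)
  (B (w e e')) (B (w e y)) (B (w x e')) (B (w x y)) lr lr' ex ex' dfw
  (ltW p0) (ltW s0).
rewrite -/I -/L => H; rewrite ler_pdivrMl//.
apply: (le_trans (H _)) => {H}; last first.
  rewrite le_eqVlt; apply/orP; left; apply/eqP; rewrite /B /S; field.
  by rewrite pN0 qN0 !gt_eqF.
move=> u v uI vI.
have uI' : l <= u <= r by move: uI => /andP[? ?]; rewrite !ltW.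
have vI' : l' <= v <= r' by move: vI => /andP[? ?]; rewrite !ltW.
have t0 := weight_ge0 lr ex uI'.
have la0 := weight_ge0 lr' ex' vI'.
have := coord_s_convex2_corners lr lr' ex ex' conv uI' vI'.
set t := (x - u) / _ in t0 *; set la := (y - v) / _ in la0 *.
set t' := (e - u) / _; set la' := (e' - v) / _ => cc.
clearbody t la t' la'.
(* The scaling by [tau] is invisible in the product, not in its Young bound. *)
have -> : t * la * `|w u v| = tau * (t * la) * (tau^-1 * `|w u v|) by field.
have a0 : 0 <= tau * (t * la) by rewrite !mulr_ge0 ?(ltW tau0).
have b0 : 0 <= tau^-1 * `|w u v| by rewrite mulr_ge0 ?invr_ge0 ?(ltW tau0).
apply: (le_trans (conjugate_powR a0 b0 p0 q0 pq)).
rewrite !powRM ?mulr_ge0 ?invr_ge0 ?(ltW tau0)//.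
rewrite -addrA; apply: lerD.
  by rewrite le_eqVlt; apply/orP; left; apply/eqP; ring.
rewrite mulrAC.
apply: (le_trans (ler_wpM2l _ cc)); first by rewrite divr_ge0 ?powR_ge0 ?(ltW q0).
by rewrite le_eqVlt; apply/orP; left; apply/eqP; rewrite /B; ring.
Qed.
(** * Decomposition into four quadrants *)

Lemma Rintegral_itv_split (R : realType) (l m r : R) (g : R -> R) :
  l <= m <= r -> {within `[l, r], continuous g} ->
  \int[lebesgue_measure]_(u in `[l, r]) g u =
  \int[lebesgue_measure]_(u in `[l, m]) g u +
  \int[lebesgue_measure]_(u in `[m, r]) g u.
Proof.
move=> /andP[lm mr] /continuous_itv_integrable ig.
apply/eqP; rewrite addrC -subr_eq; apply/eqP.
rewrite (Rintegral_itvB ig) ?bnd_simp// Rintegral_itv_obnd_cbnd//.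
by apply: integrableS ig => //; apply: subset_itv; rewrite bnd_simp.
Qed.

Lemma Rintegral_itv_splitD (R : realType) (l m r : R) (g g1 g2 : R -> R) :
  l <= m <= r -> {within `[l, r], continuous g1} -> {within `[l, r], continuous g2} ->
  (forall u, l <= u <= r -> g u = g1 u + g2 u) ->
  \int[lebesgue_measure]_(u in `[l, r]) g u =
  \int[lebesgue_measure]_(u in `[l, m]) g1 u +
  \int[lebesgue_measure]_(u in `[m, r]) g1 u +
  (\int[lebesgue_measure]_(u in `[l, m]) g2 u +
   \int[lebesgue_measure]_(u in `[m, r]) g2 u).
Proof.
move=> mI c1 c2 gE.
rewrite -(Rintegral_itv_split mI c1) -(Rintegral_itv_split mI c2) -RintegralD//.
- by apply: eq_Rintegral => u; rewrite inE/= in_itv/=; exact: gE.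
- exact: continuous_itv_integrable c1.
- exact: continuous_itv_integrable c2.
Qed.

Lemma Rintegral_quadrant (R : realType) (l r l' r' e e' : R)
    (f fv w : R -> R -> R) (M : R) :
  l <= r -> l' <= r' -> l <= e <= r -> l' <= e' <= r' ->
  mixed_derives l r l' r' f fv w M ->
  \int[lebesgue_measure]_(v in `[l', r'])
    \int[lebesgue_measure]_(u in `[l, r]) (f u v - f e v - (f u e' - f e e')) =
  \int[lebesgue_measure]_(v in `[l', r']) \int[lebesgue_measure]_(u in `[l, r]) f u v
  - (r - l) * \int[lebesgue_measure]_(v in `[l', r']) f e v
  - (r' - l') * \int[lebesgue_measure]_(u in `[l, r]) f u e'
  + (r - l) * (r' - l') * f e e'.
Proof.
move=> lr lr' eI e'I dfw; have [cf df _ _] := dfw.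
have ccst (z1 z2 k : R) : (@lebesgue_measure R).-integrable `[z1, z2] (EFin \o (fun=> k)).
  by apply: continuous_itv_integrable => u; exact: cvg_cst.
have i1 v : l' <= v <= r' -> (@lebesgue_measure R).-integrable `[l, r] (EFin \o f ^~ v).
  by move=> /cf; exact: continuous_itv_integrable.
have i1e v : l' <= v <= r' ->
    (@lebesgue_measure R).-integrable `[l, r] (EFin \o (fun u => f u v - f e v)).
  move=> /cf cfv; apply: continuous_itv_integrable => u.
  exact: cvgB (cfv u) (cvg_cst _).
transitivity (\int[lebesgue_measure]_(v in `[l', r'])
    (\int[lebesgue_measure]_(u in `[l, r]) f u v - f e v * (r - l) -
     (\int[lebesgue_measure]_(u in `[l, r]) f u e' - f e e' * (r - l)))).
  apply: eq_Rintegral => v; rewrite inE/= in_itv/= => vI.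
  rewrite RintegralB//; last 2 first.
  - exact: i1e.
  - exact: i1e.
  by rewrite !RintegralB ?Rintegral_itv_cst//; exact: i1.
have cI := continuous_Rintegral1 lr lr' dfw.
have cfe := (df _ eI).1.
have ce : {within `[l', r'], continuous (fun v => f e v * (r - l))}.
  by move=> v; exact: cvgM (cfe v) (cvg_cst _).
rewrite RintegralB//; last first.
  by apply: continuous_itv_integrable => v; exact: cvgB (cI v) (ce v).
rewrite RintegralB//; [|exact: continuous_itv_integrable..].
rewrite RintegralZr//; last exact: continuous_itv_integrable.
rewrite Rintegral_itv_cst//; ring.
Qed.

(** The bound on the mixed derivative comes from convexity of its [q]-th power. *)
Lemma mixed_derives_mixed_partial (R : realType) (a b c d q s : R)
    (f : R -> R -> R) : a < b -> c < d -> 0 < q -> 0 < s ->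
  partially_differentiable a b c d f -> has_mixed_partial a b c d f ->
  coord_s_convex2 s a b c d (fun u v => `|mixed_partial a b c d f u v| `^ q) ->
  exists M, mixed_derives a b c d f (partial2 c d f) (mixed_partial a b c d f) M.
Proof.
move=> ab cd q0 s0 pf mf conv.
set D := mixed_partial a b c d f in conv *.
exists ((`|D a c| `^ q + `|D a d| `^ q + `|D b c| `^ q + `|D b d| `^ q) `^ q^-1).
have rect u v : a <= u <= b -> c <= v <= d -> rectangle a b c d (u, v).
  by move=> uI vI; split; rewrite /= in_itv.
split.
- move=> v vI; apply: (derivable_on_derives_to _).1 => u uI.
  exact: (pf u v (rect _ _ uI vI)).1.
- move=> u uI; apply: derivable_on_derives_to => v vI.
  exact: (pf u v (rect _ _ uI vI)).2.
- move=> v vI; apply: derivable_on_derives_to => u uI.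
  exact: mf u v (rect _ _ uI vI).
- move=> u v uI vI.
  have := coord_s_convex2_bounded s0 ab cd _ conv uI vI.
  move=> /(_ (fun _ _ => powR_ge0 _ _)) DS.
  have -> : `|D u v| = (`|D u v| `^ q) `^ q^-1.
    by rewrite -powRrM divff ?gt_eqF// powRr1.
  by rewrite ge0_ler_powR// ?invr_ge0 ?nnegrE ?addr_ge0 ?powR_ge0 ?ltW.
Qed.

Section quadrants.
Variables (R : realType) (a b c d : R) (f fv w : R -> R -> R) (M : R).
Hypotheses (ab : a < b) (cd : c < d).
Hypothesis dfw : mixed_derives a b c d f fv w M.

Let J l r v : R := \int[lebesgue_measure]_(u in `[l, r]) f u v.

Let I l r l' r' : R := \int[lebesgue_measure]_(v in `[l', r']) J l r v.

Let cI l r : a <= l -> l <= r -> r <= b ->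
  {within `[c, d], continuous (J l r)}.
Proof.
move=> al lr rb; apply: (continuous_Rintegral1 lr (ltW cd)).
exact: (mixed_derivesS al rb (lexx c) (lexx d) dfw).
Qed.

Lemma Rintegral_quadrants x y : a <= x <= b -> c <= y <= d ->
  I a b c d = I a x c y + I a x y d + (I x b c y + I x b y d).
Proof.
move=> xI yI; have /andP[ax xb] := xI; have [cf _ _ _] := dfw.
have c1 := cI (lexx a) ax xb.
have c2 := cI ax xb (lexx b).
apply: (Rintegral_itv_splitD yI c1 c2) => v vI.
exact: Rintegral_itv_split xI (cf v vI).
Qed.

Let T l r l' r' e e' : R := \int[lebesgue_measure]_(v in `[l', r'])
  \int[lebesgue_measure]_(u in `[l, r]) (f u v - f e v - (f u e' - f e e')).

(** Each term of the left-hand side collects the corresponding terms of the four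
expanded increments: the corner values weighted by the areas of their
quadrants, the sides by the widths of the adjacent strips. *)
Lemma quadrant_decomposition x y : a <= x <= b -> c <= y <= d ->
  corner_term a b c d x y f
  - (x - a) * (\int[lebesgue_measure]_(v in `[c, d]) f a v)
  - (b - x) * (\int[lebesgue_measure]_(v in `[c, d]) f b v)
  - (d - y) * (\int[lebesgue_measure]_(u in `[a, b]) f u d)
  - (y - c) * (\int[lebesgue_measure]_(u in `[a, b]) f u c)
  + \int[lebesgue_measure]_(u in `[a, b]) (\int[lebesgue_measure]_(v in `[c, d]) f u v)
  = T a x c y a c + T a x y d a d + T x b c y b c + T x b y d b d.
Proof.
move=> xI yI; have [cf df _ _] := dfw.
have /andP[ax xb] := xI; have /andP[cy yd] := yI.
have [abW cdW] := (ltW ab, ltW cd).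
pose V e l' r' : R := \int[lebesgue_measure]_(v in `[l', r']) f e v.
pose U e' l r : R := \int[lebesgue_measure]_(u in `[l, r]) f u e'.
have splitV e : a <= e <= b -> V e c d = V e c y + V e y d.
  by move=> eI; exact: Rintegral_itv_split yI (df _ eI).1.
have splitU e' : c <= e' <= d -> U e' a b = U e' a x + U e' x b.
  by move=> eI; exact: Rintegral_itv_split xI (cf _ eI).
have ends (l r : R) : l <= r -> (l <= l <= r) /\ (l <= r <= r).
  by move=> lr; rewrite !lexx lr.
have Tac : T a x c y a c = I a x c y - (x - a) * V a c y - (y - c) * U c a x +
    (x - a) * (y - c) * f a c.
  exact: Rintegral_quadrant ax cy (ends _ _ ax).1 (ends _ _ cy).1
    (mixed_derivesS (lexx a) xb (lexx c) yd dfw).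
have Tad : T a x y d a d = I a x y d - (x - a) * V a y d - (d - y) * U d a x +
    (x - a) * (d - y) * f a d.
  exact: Rintegral_quadrant ax yd (ends _ _ ax).1 (ends _ _ yd).2
    (mixed_derivesS (lexx a) xb cy (lexx d) dfw).
have Tbc : T x b c y b c = I x b c y - (b - x) * V b c y - (y - c) * U c x b +
    (b - x) * (y - c) * f b c.
  exact: Rintegral_quadrant xb cy (ends _ _ xb).2 (ends _ _ cy).1
    (mixed_derivesS ax (lexx b) (lexx c) yd dfw).
have Tbd : T x b y d b d = I x b y d - (b - x) * V b y d - (d - y) * U d x b +
    (b - x) * (d - y) * f b d.
  exact: Rintegral_quadrant xb yd (ends _ _ xb).2 (ends _ _ yd).2
    (mixed_derivesS ax (lexx b) cy (lexx d) dfw).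
have total : \int[lebesgue_measure]_(u in `[a, b])
    \int[lebesgue_measure]_(v in `[c, d]) f u v =
    I a x c y + I a x y d + (I x b c y + I x b y d).
  rewrite -(Rintegral_quadrants xI yI).
  exact: Rintegral_exchange (mixed_derives_continuous abW cdW dfw).
rewrite total Tac Tad Tbc Tbd /corner_term.
rewrite -/(V a c d) -/(V b c d) -/(U c a b) -/(U d a b).
rewrite (splitV _ (ends _ _ abW).1) (splitV _ (ends _ _ abW).2).
rewrite (splitU _ (ends _ _ cdW).1) (splitU _ (ends _ _ cdW).2).
(* The identity is linear in the twelve remaining integrals, now variables. *)
move: (I a x c y) (I a x y d) (I x b c y) (I x b y d) => I1 I2 I3 I4.
move: (V a c y) (V a y d) (V b c y) (V b y d) => V1 V2 V3 V4.
move: (U c a x) (U c x b) (U d a x) (U d x b) => U1 U2 U3 U4.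
ring.
Qed.

Lemma quadrants_bound (p q s x y : R) : 0 < p -> 0 < q -> p^-1 + q^-1 = 1 -> 0 < s ->
  coord_s_convex2 s a b c d (fun u v => `|w u v| `^ q) ->
  a <= x <= b -> c <= y <= d ->
  `|T a x c y a c + T a x y d a d + T x b c y b c + T x b y d b d| <=
  ((p + 1) `^ (2 / p))^-1 * ((s + 1) `^ (2 / q))^-1 *
  ((x - a) ^+ 2 * (y - c) ^+ 2 *
     (`|w x y| `^ q + `|w x c| `^ q + `|w a y| `^ q + `|w a c| `^ q) `^ q^-1
   + (x - a) ^+ 2 * (d - y) ^+ 2 *
     (`|w x y| `^ q + `|w x d| `^ q + `|w a y| `^ q + `|w a d| `^ q) `^ q^-1
   + (b - x) ^+ 2 * (y - c) ^+ 2 *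
     (`|w x y| `^ q + `|w x c| `^ q + `|w b y| `^ q + `|w b c| `^ q) `^ q^-1
   + (b - x) ^+ 2 * (d - y) ^+ 2 *
     (`|w x y| `^ q + `|w x d| `^ q + `|w b y| `^ q + `|w b d| `^ q) `^ q^-1).
Proof.
move=> p0 q0 pq s0 conv /andP[ax xb] /andP[cy yd].
have left_end (l r : R) : opposite_ends l r l r by left.
have right_end (l r : R) : opposite_ends l r r l by right.
have ac := quadrant_bound ax cy (left_end a x) (left_end c y)
  (mixed_derivesS (lexx a) xb (lexx c) yd dfw) p0 q0 pq s0
  (coord_s_convex2S (lexx a) xb (lexx c) yd conv).
have ad := quadrant_bound ax yd (left_end a x) (right_end y d)
  (mixed_derivesS (lexx a) xb cy (lexx d) dfw) p0 q0 pq s0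
  (coord_s_convex2S (lexx a) xb cy (lexx d) conv).
have bc := quadrant_bound xb cy (right_end x b) (left_end c y)
  (mixed_derivesS ax (lexx b) (lexx c) yd dfw) p0 q0 pq s0
  (coord_s_convex2S ax (lexx b) (lexx c) yd conv).
have bd := quadrant_bound xb yd (right_end x b) (right_end y d)
  (mixed_derivesS ax (lexx b) cy (lexx d) dfw) p0 q0 pq s0
  (coord_s_convex2S ax (lexx b) cy (lexx d) conv).
have tri (t1 t2 t3 t4 : R) :
    `|t1 + t2 + t3 + t4| <= `|t1| + `|t2| + `|t3| + `|t4|.
  by do 3 (apply: (le_trans (ler_normD _ _)); rewrite lerD2r).
apply: (le_trans (tri _ _ _ _)).
apply: (le_trans (lerD (lerD (lerD ac ad) bc) bd)).
set C := _^-1 * _^-1.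
have factor (L1 L2 L3 L4 S1 S2 S3 S4 : R) :
    L1 * (C * S1) + L2 * (C * S2) + L3 * (C * S3) + L4 * (C * S4) =
    C * (L1 * S1 + L2 * S2 + L3 * S3 + L4 * S4).
  by clearbody C; ring.
by rewrite factor.
Qed.

End quadrants.

Theorem theorem3 (R : realType) (a b c d : R) (f : R -> R -> R) (p q s : R)
  (ha : 0 <= a) (hab : a < b) (hc : 0 <= c) (hcd : c < d)
  (hf : partially_differentiable a b c d f)
  (hmixed : has_mixed_partial a b c d f)
  (hint : integrable_on_rectangle a b c d (mixed_partial a b c d f))
  (hq : 1 < q) (hpq : p^-1 + q^-1 = 1) (hs0 : 0 < s) (hs1 : s <= 1)
  (D := fun u v : R => `|mixed_partial a b c d f u v|)
  (hconv : coord_s_convex2 s a b c d (fun u v => D u v `^ q))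
  (x y : R) (hx : a <= x <= b) (hy : c <= y <= d) :
  `| ((b - a) * (d - c))^-1 *
      (corner_term a b c d x y f
       - (x - a) * (\int[lebesgue_measure]_(v in `[c, d]) f a v)
       - (b - x) * (\int[lebesgue_measure]_(v in `[c, d]) f b v)
       - (d - y) * (\int[lebesgue_measure]_(u in `[a, b]) f u d)
       - (y - c) * (\int[lebesgue_measure]_(u in `[a, b]) f u c)
       + \int[lebesgue_measure]_(u in `[a, b])
           (\int[lebesgue_measure]_(v in `[c, d]) f u v)) |
  <= ((p + 1) `^ (2 / p))^-1 * ((s + 1) `^ (2 / q))^-1 *
     ( (x - a) ^+ 2 * (y - c) ^+ 2 / ((b - a) * (d - c)) *
         (D x y `^ q + D x c `^ q + D a y `^ q + D a c `^ q) `^ q^-1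
     + (x - a) ^+ 2 * (d - y) ^+ 2 / ((b - a) * (d - c)) *
         (D x y `^ q + D x d `^ q + D a y `^ q + D a d `^ q) `^ q^-1
     + (b - x) ^+ 2 * (y - c) ^+ 2 / ((b - a) * (d - c)) *
         (D x y `^ q + D x c `^ q + D b y `^ q + D b c `^ q) `^ q^-1
     + (b - x) ^+ 2 * (d - y) ^+ 2 / ((b - a) * (d - c)) *
         (D x y `^ q + D x d `^ q + D b y `^ q + D b d `^ q) `^ q^-1 ).
Proof.
have q0 : 0 < q by lra.
have qV1 : q^-1 < 1 by rewrite invf_lt1.
have p0 : 0 < p by rewrite -invr_gt0; lra.
have [M dfw] := mixed_derives_mixed_partial hab hcd q0 hs0 hf hmixed hconv.
rewrite (quadrant_decomposition hab hcd dfw hx hy).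
have area_gt0 : 0 < (b - a) * (d - c) by rewrite mulr_gt0 ?subr_gt0.
rewrite normrM normfV (gtr0_norm area_gt0) mulrC ler_pdivrMr//.
have factor (K C L1 L2 L3 L4 S1 S2 S3 S4 : R) : 0 < K ->
    C * (L1 * S1 + L2 * S2 + L3 * S3 + L4 * S4) =
    C * (L1 / K * S1 + L2 / K * S2 + L3 / K * S3 + L4 / K * S4) * K.
  by move=> K0; field; rewrite gt_eqF.
rewrite -factor//; exact: (quadrants_bound dfw p0 q0 hpq hs0 hconv hx hy).
Qed.
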